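(* There is no bicrucial permutation with respect to squares of length $11$, while bicrucial permutations with respect to squares of length $19$ and of length $27$ exist.
   Context: Permutations are written in one-line notation. A factor is a sequence of consecutive entries; two sequences of distinct numbers of equal length are order-isomorphic if their entries are in the same relative order. A square is a factor $XY$ with $X,Y$ consecutive, of equal length at least $2$, and order-isomorphic. A permutation is square-free if it contains no square. For $\pi=\pi_1\cdots\pi_n$, $x\in\{1,\dots,n+1\}$ and $i\in\{0,\dots,n\}$, the extension of $\pi$ by $x$ in position $i$ is $\pi'_1\cdots\pi'_i\,x\,\pi'_{i+1}\cdots\pi'_n$, where $\pi'_j=\pi_j$ if $\pi_j<x$ and $\pi'_j=\pi_j+1$ otherwise; $i=0$ gives an extension to the left and $i=n$ an extension to the right. A permutation is bicrucial with respect to squares if it is square-free but every extension of it to the left and every extension of it to the right (by any element) contains a square. *)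

(* Defs.v *)
From mathcomp Require Import all_boot all_fingroup.

Set Implicit Arguments.
Unset Strict Implicit.
Unset Printing Implicit Defensive.

(* 'I_n is {0, ..., n-1}: entries are shifted by one, so that the word of a
   permutation of length n has entries 1, ..., n. *)
Definition one_line (n : nat) (p : 'S_n) : seq nat :=
  [seq (p i : nat).+1 | i <- enum 'I_n].

Definition order_isomorphic (u v : seq nat) : Prop :=
  size u = size v /\
  forall i j : nat, i < size u -> j < size u ->
    (nth 0 u i < nth 0 u j) = (nth 0 v i < nth 0 v j).

Definition is_square (w : seq nat) : Prop :=
  exists X Y : seq nat,
    [/\ w = X ++ Y, size X = size Y, 2 <= size X & order_isomorphic X Y].

Definition contains_square (n : nat) (p : 'S_n) : Prop :=
  exists2 w : seq nat, infix w (one_line p) & is_square w.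

Definition square_free (n : nat) (p : 'S_n) : Prop := ~ contains_square p.

(* [lift_perm i x p] sends the position i to x and relabels the remaining
   positions and entries by skipping i and x, respectively. With x : 'I_n.+1
   standing for the entry x+1, this inserts x+1 after the first i entries and
   raises by one the entries that are at least x+1 (see [one_line_extension]). *)
Definition extension (n : nat) (p : 'S_n) (x i : 'I_n.+1) : 'S_n.+1 :=
  lift_perm i x p.

Lemma one_line_extension (n : nat) (p : 'S_n) (x i : 'I_n.+1) :
  let p' := [seq if a < x.+1 then a else a.+1 | a <- one_line p] in
  one_line (extension p x i) = take i p' ++ x.+1 :: drop i p'.
Proof.
have sz_p : size (one_line p) = n by rewrite size_map size_enum_ord.
move=> p'; have sz_p' : size p' = n by rewrite size_map.
have ile : i <= n by rewrite -ltnS.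
apply: (@eq_from_nth _ 0) => [|k].
  rewrite size_map size_enum_ord size_cat /= size_drop size_takel sz_p' //.
  by rewrite addnS subnKC.
rewrite size_map size_enum_ord => ltk.
rewrite (nth_map ord0) ?size_enum_ord // nth_cat size_takel ?sz_p' //.
have -> : nth ord0 (enum 'I_n.+1) k = Ordinal ltk.
  by apply: val_inj; rewrite /= nth_enum_ord.
have nthp' (j : 'I_n) : nth 0 p' j = (lift x (p j)).+1.
  rewrite (nth_map 0) ?sz_p //.
  rewrite (nth_map j) ?size_enum_ord // nth_ord_enum /= /bump ltnS.
  by case: leqP.
have [j def_k|def_k] := unliftP i (Ordinal ltk).
  have Dk : k = bump i j by rewrite -[RHS]/(val (lift i j)) -def_k.
  rewrite def_k /extension lift_perm_lift -nthp' Dk /bump.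
  case: (leqP i j) => [leij|ltji]; last by rewrite add0n ltji nth_take.
  by rewrite add1n ltnNge leqW //= subSn //= nth_drop subnKC.
have Dk : k = i by rewrite -def_k.
by rewrite def_k /extension lift_perm_id Dk ltnn subnn.
Qed.

Definition bicrucial (n : nat) (p : 'S_n) : Prop :=
  [/\ square_free p,
      forall x : 'I_n.+1, contains_square (extension p x ord0) &
      forall x : 'I_n.+1, contains_square (extension p x ord_max)].

(* Main.v *)
Require Import Defs.
From mathcomp Require Import all_boot all_fingroup zify.

Set Implicit Arguments.
Unset Strict Implicit.
Unset Printing Implicit Defensive.

(* Since a word without squares of length 4 rises and falls with the pattern
   UUDDUUDD..., the half-length of any longer square in it is a multiple of 4.
   An extension of a square-free permutation of length 11 on the side of the
   end entry that avoids a square of length 4 must therefore create a square of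
   length 8. Inserting both an extreme entry and one adjacent in value to the
   end entry shows that, up to complement, the last seven entries are ordered
   like 3421 followed by 231, and the first seven like the mirror image; for
   length 11 these windows share the entries 5 to 7 and contradict each other
   there. For lengths 19 and 27 explicit permutations are checked by
   computation. *)

(** * Squares in words as a decidable property *)

(** The bound on [size w] keeps every [nth 0] off its default value, so [has_square] may scan ranges
    of starts and half-lengths that overshoot. *)
Definition square_at (w : seq nat) (i k : nat) : bool :=
  [&& 1 < k, i + k.*2 <= size w &
    all (fun a => all (fun b =>
      (nth 0 w (i + a) < nth 0 w (i + b)) ==
      (nth 0 w (i + k + a) < nth 0 w (i + k + b))) (iota 0 k)) (iota 0 k)].

Definition has_square (w : seq nat) : bool :=
  has (fun k => has (square_at w ^~ k) (iota 0 (size w))) (iota 2 (size w)).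

Lemma square_atP (w : seq nat) (i k : nat) :
  reflect [/\ 1 < k, i + k.*2 <= size w & forall a b, a < k -> b < k ->
             (nth 0 w (i + a) < nth 0 w (i + b)) =
             (nth 0 w (i + k + a) < nth 0 w (i + k + b))]
          (square_at w i k).
Proof.
apply: (iffP and3P) => -[k_gt1 le_w sq]; split=> //.
  move=> a b ltak ltbk.
  have /allP sq_a := allP sq a ltac:(by rewrite mem_iota).
  by apply: (eqP (sq_a b _)); rewrite mem_iota.
apply/allP=> a; rewrite mem_iota => /andP[_ ltak].
by apply/allP=> b; rewrite mem_iota => /andP[_ ltbk]; apply/eqP/sq.
Qed.

Lemma has_squareP (w : seq nat) :
  reflect (exists i k, square_at w i k) (has_square w).
Proof.
apply: (iffP hasP) => [[k _ /hasP[i _ sq]]|[i [k sq]]]; first by exists i, k.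
have [k_gt1 le_w _] := square_atP _ _ _ sq.
exists k; first by rewrite mem_iota; lia.
by apply/hasP; exists i; rewrite // mem_iota; lia.
Qed.

Lemma contains_squareP (n : nat) (p : 'S_n) :
  contains_square p <-> has_square (one_line p).
Proof.
split=> [[w /infixP[u [v Dw]] [X [Y [DXY eqXY k_gt1 [_ iso]]]]]|].
  apply/has_squareP; exists (size u), (size X); apply/square_atP.
  rewrite Dw DXY; split=> [//||].
    by rewrite !size_cat -eqXY -addnn leq_add2l leq_addr.
  have nthu c : nth 0 (u ++ (X ++ Y) ++ v) (size u + c) = nth 0 (X ++ Y ++ v) c.
    by rewrite [LHS]nth_cat addKn ltnNge leq_addr /= catA.
  move=> a b ltak ltbk; rewrite -!addnA !nthu !nth_cat ltak ltbk iso //.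
  by rewrite !addKn -eqXY ltak ltbk !ltnNge !leq_addr.
case/has_squareP=> i [k /square_atP[k_gt1 le_w iso]].
set w := one_line p in le_w iso *.
have szX : size (take k (drop i w)) = k by rewrite size_takel // size_drop; lia.
have szY : size (take k (drop (i + k) w)) = k.
  by rewrite size_takel // size_drop; lia.
exists (take k.*2 (drop i w)).
  apply/infixP; exists (take i w), (drop k.*2 (drop i w)).
  by rewrite !cat_take_drop.
exists (take k (drop i w)), (take k (drop (i + k) w)).
split; rewrite ?szX ?szY //.
  by rewrite -addnn takeD drop_drop addnC.
split; rewrite ?szX ?szY // => a b ltak ltbk.
by rewrite !nth_take // !nth_drop iso.
Qed.

(** * Words of permutations and of their extensions *)

Lemma size_one_line (n : nat) (p : 'S_n) : size (one_line p) = n.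
Proof. by rewrite size_map size_enum_ord. Qed.

Lemma one_line_uniq (n : nat) (p : 'S_n) : uniq (one_line p).
Proof.
rewrite map_inj_uniq ?enum_uniq // => i j /succn_inj eq_p.
by apply: (@perm_inj _ p); apply: val_inj.
Qed.

Lemma one_line_neq (n : nat) (p : 'S_n) (i j : nat) : i < j < n ->
  nth 0 (one_line p) i <> nth 0 (one_line p) j.
Proof.
move=> /andP[ltij ltjn]; apply/eqP.
rewrite nth_uniq ?size_one_line ?one_line_uniq ?(ltn_trans ltij) //.
by rewrite ltn_eqF.
Qed.

Lemma one_line_bounds (n : nat) (p : 'S_n) (i : nat) :
  i < n -> 0 < nth 0 (one_line p) i <= n.
Proof.
move=> ltin; rewrite (nth_map (Ordinal ltin)) ?size_enum_ord //.
exact: ltn_ord.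
Qed.

Lemma one_line_onto (n : nat) (s : seq nat) :
  perm_eq s (iota 1 n) -> exists p : 'S_n, one_line p = s.
Proof.
move=> perm_s; have sz_s : size s = n by rewrite (perm_size perm_s) size_iota.
have bound (i : 'I_n) : 0 < nth 0 s i <= n.
  have := mem_nth 0 (_ : i < size s); rewrite sz_s => /(_ (ltn_ord i)).
  by rewrite (perm_mem perm_s) mem_iota add1n.
have lt_n (i : 'I_n) : (nth 0 s i).-1 < n by have := bound i; lia.
have inj_f : injective (fun i => Ordinal (lt_n i)).
  move=> i j [eq_ij]; apply/val_inj/eqP => /=.
  (* Entries are positive, so [.-1] identifies no two of them. *)
  have eq_s : nth 0 s i = nth 0 s j by have := bound i; have := bound j; lia.
  rewrite -(nth_uniq 0 _ _ (_ : uniq s)) ?sz_s ?eq_s //.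
  by rewrite (perm_uniq perm_s) iota_uniq.
exists (perm inj_f); apply: (@eq_from_nth _ 0); rewrite size_one_line //.
move=> i ltin; rewrite (nth_map (Ordinal ltin)) ?size_enum_ord // permE /=.
by rewrite nth_enum_ord // prednK //; case/andP: (bound (Ordinal ltin)).
Qed.

Definition raise (x : nat) (w : seq nat) : seq nat :=
  [seq if a < x.+1 then a else a.+1 | a <- w].

Lemma one_line_extension_left (n : nat) (p : 'S_n) (x : 'I_n.+1) :
  one_line (extension p x ord0) = x.+1 :: raise x (one_line p).
Proof. by rewrite one_line_extension take0 drop0. Qed.

Lemma one_line_extension_right (n : nat) (p : 'S_n) (x : 'I_n.+1) :
  one_line (extension p x ord_max) = rcons (raise x (one_line p)) x.+1.
Proof.
by rewrite one_line_extension take_oversize ?drop_oversize ?cats1 //;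
  rewrite size_map size_one_line.
Qed.

(** Stated on bare lists so that witnesses are checked by evaluation, without computing with
    permutations. *)
Definition bicrucial_word (w : seq nat) : bool :=
  [&& perm_eq w (iota 1 (size w)), ~~ has_square w,
      all (fun x => has_square (x.+1 :: raise x w)) (iota 0 (size w).+1) &
      all (fun x => has_square (rcons (raise x w) x.+1)) (iota 0 (size w).+1)].

Lemma bicrucial_word_exists (w : seq nat) :
  bicrucial_word w -> exists p : 'S_(size w), bicrucial p.
Proof.
case/and4P=> /one_line_onto[p Dp] sqf /allP left /allP right.
exists p; split=> [/contains_squareP|x|x]; first by rewrite Dp (negPf sqf).
  apply/contains_squareP; rewrite one_line_extension_left Dp.
  by rewrite left ?mem_iota /=.
apply/contains_squareP; rewrite one_line_extension_right Dp.
by rewrite right ?mem_iota /=.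
Qed.

(** * Rises, falls and half-lengths of squares *)

(** Rises and falls swap after two steps, while a square makes steps 0 and [k] agree, and likewise
    steps 1 and [k.+1]. For [k = q.*2] this forces [q] to be even; for [k = q.*2.+1] the two
    agreements contradict each other. *)
Lemma square_length_dvd (w : seq nat) (i k : nat) :
  square_at w i k -> 2 < k ->
  (forall j, i <= j -> j + 3 < i + k.*2 ->
     (nth 0 w j < nth 0 w j.+1) != (nth 0 w j.+2 < nth 0 w j.+3)) ->
  4 %| k.
Proof.
case/square_atP=> _ _ sq k_gt2 alt.
pose s j := nth 0 w (i + j) < nth 0 w (i + j).+1.
have sS j : j + 3 < k.*2 -> s j.+2 = ~~ s j.
  move=> ltj; have := alt (i + j) ltac:(lia) ltac:(lia).
  by rewrite negb_eqb /s !addnS => /addbP.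
have s2 q j : j + q.*2.+1 < k.*2 -> s (j + q.*2) = odd q (+) s j.
  elim: q => [|q IHq] ltj; first by rewrite addn0.
  by rewrite doubleS !addnS sS ?IHq /=; [case: odd (s j) => -[] | lia | lia].
have sqs a : a.+1 < k -> s a = s (k + a).
  move=> lta; have := sq a a.+1; rewrite /s !addnS !addnA.
  by apply; lia.
have s0 : s 0 = s k by rewrite sqs ?addn0 //; lia.
have s1 : s 1 = s k.+1 by rewrite sqs ?addn1 //; lia.
have [q [Dk|Dk]] : exists q, k = q.*2 \/ k = q.*2.+1.
  by exists k./2; lia.
  have := s2 q 0; rewrite !add0n -Dk -s0.
  by case q_odd: (odd q); [case: (s 0) => H; have := H ltac:(lia) | lia].
have := s2 q 1; have := s2 q.+1 0; rewrite !add0n !add1n doubleS -Dk -s0 -s1 /=.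
case: (odd q) (s 0) (s 1) => -[] [] H1 H2;
  by have := H1 ltac:(lia); have := H2 ltac:(lia).
Qed.

(** Two pairs of distinct entries are order-isomorphic once both rise or both fall, so equality here
    would give a square of length 4. *)
Lemma square_free_alternates (n : nat) (p : 'S_n) (w := one_line p) (j : nat) :
  square_free p -> j + 3 < n ->
  (nth 0 w j < nth 0 w j.+1) != (nth 0 w j.+2 < nth 0 w j.+3).
Proof.
move=> sqf ltjn; apply/eqP=> eq_j; apply/sqf/contains_squareP/has_squareP.
exists j, 2; apply/square_atP; rewrite size_one_line; split=> //; first by lia.
have asym i : i.+1 < n ->
    (nth 0 w i.+1 < nth 0 w i) = ~~ (nth 0 w i < nth 0 w i.+1).
  move=> lti; rewrite -leqNgt ltn_neqAle.
  have /eqP/negPf := @one_line_neq _ p i i.+1 ltac:(lia).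
  by rewrite eq_sym => ->.
case=> [|[|//]] [|[|//]] _ _; rewrite ?addn0 ?addn1 ?addn2 ?ltnn //.
by rewrite !asym ?eq_j //; lia.
Qed.

(** * Squares created by an extension *)

Lemma nth_raise (x : nat) (w : seq nat) (i : nat) : i < size w ->
  nth 0 (raise x w) i =
  if nth 0 w i <= x then nth 0 w i else (nth 0 w i).+1.
Proof. exact: nth_map. Qed.

Lemma nth_raise_lt (x : nat) (w : seq nat) (i j : nat) :
  i < size w -> j < size w ->
  (nth 0 (raise x w) i < nth 0 (raise x w) j) = (nth 0 w i < nth 0 w j).
Proof. by move=> lti ltj; rewrite !nth_raise //; do 2!case: ifP; lia. Qed.

(** Pulls a square of an extension back to the original word: [d] is 0 for extensions to the right
    and 1 for those to the left. *)
Lemma square_atW (w v : seq nat) (d i k : nat) :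
  square_at v (d + i) k -> i + k.*2 <= size w ->
  (forall a b, a < size w -> b < size w ->
     (nth 0 v (d + a) < nth 0 v (d + b)) = (nth 0 w a < nth 0 w b)) ->
  square_at w i k.
Proof.
move=> /square_atP[k_gt1 _ sq] le_w eq_vw; apply/square_atP; split=> //.
move=> a b lta ltb; by rewrite -!eq_vw ?addnA ?sq //; lia.
Qed.

(** The square must end at the new entry, as otherwise it would lie in [p]. The last hypothesis
    excludes length 4 and extends the alternation to the end of [w], so [4 %| k]; as [w] has at most
    15 entries, [k = 4]. *)
Lemma right_square4 (n : nat) (p : 'S_n) (x : 'I_n.+1)
    (w := rcons (raise x (one_line p)) x.+1) :
  2 < n < 15 -> square_free p -> contains_square (extension p x ord_max) ->
  (nth 0 w (n - 3) < nth 0 w (n - 2)) != (nth 0 w (n - 1) < nth 0 w n) ->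
  square_at w (n - 7) 4.
Proof.
move=> /andP[n_gt2 n_lt15] sqf /contains_squareP.
rewrite one_line_extension_right.
have sz_w : size w = n.+1 by rewrite size_rcons size_map size_one_line.
have eq_w a b : a < n -> b < n ->
    (nth 0 w a < nth 0 w b) = (nth 0 (one_line p) a < nth 0 (one_line p) b).
  move=> lta ltb; rewrite !nth_rcons size_map size_one_line lta ltb.
  by rewrite nth_raise_lt ?size_one_line.
case/has_squareP=> i [k sq] end_w; have [k_gt1 le_w sqE] := square_atP _ _ _ sq.
have [le_n|gt_n] := leqP (i + k.*2) n.
  case: sqf; apply/contains_squareP/has_squareP; exists i, k.
  by apply: (square_atW (d := 0) sq); rewrite size_one_line.
have Dn : n = (i + k.*2).-1 by move: le_w; rewrite sz_w; lia.
have [k2|k_gt2] : k = 2 \/ 2 < k by lia.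
  case/negP: end_w; have := sqE 0 1; rewrite k2 => /(_ isT isT) E.
  apply/eqP; congr (_ = _): E; congr (nth 0 w _ < nth 0 w _); lia.
suff /dvdnP[q Dk] : 4 %| k.
  have k4 : k = 4 by lia.
  have Di : i = n - 7 by lia.
  by rewrite -Di -k4.
apply: (square_length_dvd sq) => // j _ ltj.
have [ltjn|gejn] := ltnP (j + 3) n.
  by rewrite !eq_w ?square_free_alternates //; lia.
(* The only window reaching the new entry is covered by [end_w]. *)
have -> : j = n - 3 by lia.
have -> : (n - 3).+1 = n - 2 by lia.
have -> : (n - 2).+1 = n - 1 by lia.
by have -> : (n - 1).+1 = n by lia.
Qed.

Lemma left_square4 (n : nat) (p : 'S_n) (x : 'I_n.+1)
    (w := x.+1 :: raise x (one_line p)) :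
  2 < n < 15 -> square_free p -> contains_square (extension p x ord0) ->
  (nth 0 w 0 < nth 0 w 1) != (nth 0 w 2 < nth 0 w 3) ->
  square_at w 0 4.
Proof.
move=> /andP[n_gt2 n_lt15] sqf /contains_squareP.
rewrite one_line_extension_left.
have sz_w : size w = n.+1 by rewrite /= size_map size_one_line.
have eq_w a b : a < n -> b < n ->
    (nth 0 w a.+1 < nth 0 w b.+1) =
    (nth 0 (one_line p) a < nth 0 (one_line p) b).
  by move=> lta ltb; rewrite /= nth_raise_lt ?size_one_line.
(* A square starting at a positive position avoids the new entry and so lies in [p]. *)
case/has_squareP=> -[|i] [k sq] start_w;
    have [k_gt1 le_w sqE] := square_atP _ _ _ sq.
  have [k2|k_gt2] : k = 2 \/ 2 < k by lia.
    by case/eqP: start_w; rewrite k2 in sqE; exact: (sqE 0 1).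
  suff /dvdnP[q Dk] : 4 %| k.
    by rewrite (_ : 4 = k) //; move: le_w; rewrite sz_w; lia.
  apply: (square_length_dvd sq) => // -[|j] _ ltj //.
  by rewrite !eq_w ?square_free_alternates //; move: le_w; rewrite sz_w; lia.
case: sqf; apply/contains_squareP/has_squareP; exists i, k.
apply: (square_atW (d := 1) sq); rewrite size_one_line //.
by move: le_w; rewrite sz_w; lia.
Qed.

(** * Length 11 *)

(** The square of length 8 pairs [f 4], ..., [f 7] with [f 8], [f 9], [f 10] and the new entry. An
    extreme new entry makes [f 7] extreme in its block; one adjacent to [f 10] makes [f 6] and [f 7]
    compare alike with [f 4] and [f 5]. *)
Lemma right_end11 (p : 'S_11) (f := nth 0 (one_line p)) : square_free p ->
  (forall x, contains_square (extension p x ord_max)) ->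
  (f 6 < f 4) = (f 8 < f 9) /\ (f 6 < f 5) = (f 8 < f 9).
Proof.
move=> sqf sqR.
have bound i : i < 11 -> 0 < f i <= 11 by apply: one_line_bounds.
have sq x a : x <= 11 -> (f 8 < f 9) != (f 10 <= x) -> a < 3 ->
    (f (4 + a) < f 6) = (f (8 + a) < f 10) /\
    (f (4 + a) < f 7) = (f (8 + a) <= x).
  move=> lex end_x lta; pose y : 'I_12 := Ordinal (lex : x < 12).
  pose w := rcons (raise x (one_line p)) x.+1.
  have wE i : i < 11 -> nth 0 w i = if f i <= x then f i else (f i).+1.
    move=> lti; rewrite nth_rcons size_map size_one_line lti nth_raise //.
    by rewrite size_one_line.
  have wx : nth 0 w 11 = x.+1 by rewrite nth_rcons size_map size_one_line.
  have w_lt i j : i < 11 -> j < 11 -> (nth 0 w i < nth 0 w j) = (f i < f j).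
    by move=> lti ltj; rewrite !wE //; do 2!case: ifP; lia.
  have w_ltx i : i < 11 -> (nth 0 w i < nth 0 w 11) = (f i <= x).
    by move=> lti; rewrite wx wE //; case: ifP; lia.
  have sqw : (nth 0 w 8 < nth 0 w 9) != (nth 0 w 10 < nth 0 w 11) ->
      square_at w 4 4.
    exact: (right_square4 (x := y) isT sqf (sqR y)).
  rewrite (w_lt 8 9) // (w_ltx 10) // in sqw.
  have /square_atP[_ _ sq4] := sqw end_x.
  have := sq4 a 2 ltac:(lia) isT; have := sq4 a 3 ltac:(lia) isT.
  rewrite -[4 + 4 + 3]/11 -[4 + 4 + 2]/10 -[4 + 3]/7 -[4 + 2]/6.
  by rewrite w_ltx ?w_lt //; lia.
have b10 := bound 10 isT.
have n4 : f 4 <> f 6 by apply: one_line_neq.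
have n5 : f 5 <> f 6 by apply: one_line_neq.
have n8 : f 8 <> f 10 by apply: one_line_neq.
have n9 : f 9 <> f 10 by apply: one_line_neq.
case s8: (f 8 < f 9); rewrite s8 in sq.
  (* Avoiding a square of length 4 puts the new entry below [f 10]: just below it, or as the new
     minimum. *)
  have sqx a := sq (f 10).-1 a ltac:(lia) ltac:(lia).
  have sq0 a := sq 0 a isT ltac:(lia).
  have [x4 y4] := sqx 0 isT; have [x5 y5] := sqx 1 isT.
  have [_ z4] := sq0 0 isT; have [_ z5] := sq0 1 isT.
  have := bound 8 isT; have := bound 9 isT.
  rewrite ?addn0 ?addn1 in x4 x5 y4 y5 z4 z5 *; lia.
(* The complementary case: just above [f 10], or the new maximum. *)
have sqx a := sq (f 10) a ltac:(lia) ltac:(lia).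
have sqm a := sq 11 a isT ltac:(lia).
have [x4 y4] := sqx 0 isT; have [x5 y5] := sqx 1 isT.
have [_ z4] := sqm 0 isT; have [_ z5] := sqm 1 isT.
have := bound 8 isT; have := bound 9 isT.
rewrite ?addn0 ?addn1 in x4 x5 y4 y5 z4 z5 *; lia.
Qed.

(** Now the new entry, [f 0], [f 1], [f 2] are paired with [f 3], ..., [f 6], so that [f 3] and
    [f 4] take the roles of [f 7] and [f 6] on the right. *)
Lemma left_end11 (p : 'S_11) (f := nth 0 (one_line p)) : square_free p ->
  (forall x, contains_square (extension p x ord0)) ->
  (f 6 < f 4) = (f 1 < f 2) /\ (f 5 < f 4) = (f 1 < f 2).
Proof.
move=> sqf sqL.
have bound i : i < 11 -> 0 < f i <= 11 by apply: one_line_bounds.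
have sq x a : x <= 11 -> (x < f 0) != (f 1 < f 2) -> a < 3 ->
    (f 0 < f a) = (f 4 < f (4 + a)) /\ (x < f a) = (f 3 < f (4 + a)).
  move=> lex end_x lta; pose y : 'I_12 := Ordinal (lex : x < 12).
  pose w := x.+1 :: raise x (one_line p).
  have wE i : i < 11 -> nth 0 w i.+1 = if f i <= x then f i else (f i).+1.
    by move=> lti; rewrite /= nth_raise ?size_one_line.
  have w_lt i j : i < 11 -> j < 11 ->
      (nth 0 w i.+1 < nth 0 w j.+1) = (f i < f j).
    by move=> lti ltj; rewrite !wE //; do 2!case: ifP; lia.
  have w_xlt i : i < 11 -> (nth 0 w 0 < nth 0 w i.+1) = (x < f i).
    by move=> lti; rewrite wE //=; case: ifP; lia.
  have sqw : (nth 0 w 0 < nth 0 w 1) != (nth 0 w 2 < nth 0 w 3) ->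
      square_at w 0 4.
    exact: (left_square4 (x := y) isT sqf (sqL y)).
  rewrite (w_xlt 0) // (w_lt 1 2) // in sqw.
  have /square_atP[_ _ sq4] := sqw end_x.
  have := sq4 0 a.+1 isT ltac:(lia); have := sq4 1 a.+1 isT ltac:(lia).
  rewrite -[0 + 4 + 0]/4 -[0 + 4 + 1]/5 -[0 + 4 + a.+1]/(4 + a).+1 !add0n.
  by rewrite w_xlt ?w_lt //; lia.
have b0 := bound 0 isT.
have n5 : f 4 <> f 5 by apply: one_line_neq.
have n6 : f 4 <> f 6 by apply: one_line_neq.
have n1 : f 0 <> f 1 by apply: one_line_neq.
have n2 : f 0 <> f 2 by apply: one_line_neq.
case s1: (f 1 < f 2); rewrite s1 in sq.
  have sqx a := sq (f 0) a ltac:(lia) ltac:(lia).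
  have sqm a := sq 11 a isT ltac:(lia).
  have [x1 y1] := sqx 1 isT; have [x2 y2] := sqx 2 isT.
  have [_ z1] := sqm 1 isT; have [_ z2] := sqm 2 isT.
  have := bound 1 isT; have := bound 2 isT.
  rewrite -[4 + 1]/5 -[4 + 2]/6 in x1 x2 y1 y2 z1 z2 *; lia.
have sqx a := sq (f 0).-1 a ltac:(lia) ltac:(lia).
have sq0 a := sq 0 a isT ltac:(lia).
have [x1 y1] := sqx 1 isT; have [x2 y2] := sqx 2 isT.
have [_ z1] := sq0 1 isT; have [_ z2] := sq0 2 isT.
have := bound 1 isT; have := bound 2 isT.
rewrite -[4 + 1]/5 -[4 + 2]/6 in x1 x2 y1 y2 z1 z2 *; lia.
Qed.

Lemma no_bicrucial11 (p : 'S_11) : ~ bicrucial p.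
Proof.
move=> [sqf sqL sqR].
have [L1 L2] := left_end11 sqf sqL; have [R1 R2] := right_end11 sqf sqR.
(* By [L1] and [R1] the steps from positions 1 and 8 agree; alternation gives the step from 4 the
   direction of the one from 8, but [L2] makes it opposite to the one from 1. *)
have alt j := @square_free_alternates _ p j sqf.
have a1 := alt 1 isT; have a3 := alt 3 isT.
have a4 := alt 4 isT; have a6 := alt 6 isT.
have n45 := @one_line_neq _ p 4 5 isT.
lia.
Qed.

(** * Lengths 19 and 27 *)

(* [lazy] short-circuits the conjunctions, which [vm_compute] would not. *)
Lemma witness19 : bicrucial_word
  [:: 3; 13; 9; 7; 10; 19; 11; 6; 8; 15; 5; 1; 14; 18; 16; 4; 12; 17; 2].
Proof. by lazy. Qed.

Lemma witness27 : bicrucial_word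
  [:: 23; 18; 22; 24; 17; 11; 13; 15; 14; 1; 16; 20; 5; 2; 3; 12; 7; 4; 21; 27;
      10; 6; 8; 25; 19; 9; 26].
Proof. by lazy. Qed.

Theorem theorem5 :
  [/\ ~ (exists p : 'S_11, bicrucial p),
      exists p : 'S_19, bicrucial p &
      exists p : 'S_27, bicrucial p].
Proof.
split; first by case=> p /no_bicrucial11.
  exact: (bicrucial_word_exists witness19).
exact: (bicrucial_word_exists witness27).
Qed.
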